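(* Let $X=(X,(\mathcal{A}(x))_{x\in X})$ be an approach space. Then $X$ is probabilistic metrizable if and only if there are functions $\varphi_{\lambda,x}\in[0,\infty]^X$ ($0<\lambda\le 1$, $x\in X$) such that, with $\mathcal{B}(x)=\{\varphi_{\lambda,x}\mid 0<\lambda\le 1\}$ for $x\in X$, the family $(\mathcal{B}(x))_{x\in X}$ is a local basis of $X$ (that is, it is a local basis and $\mathcal{A}(x)=\langle\mathcal{B}(x)\rangle$ for all $x\in X$), and such that the following hold: (LS) $\varphi_{\lambda,x}(y)=\varphi_{\lambda,y}(x)$ for all $0<\lambda\le 1$ and all $x,y\in X$; (LD) $\varphi_{\lambda,x}=\inf_{0<\rho<\lambda}\varphi_{\rho,x}$ (pointwise) for all $x\in X$ and $0<\lambda\le 1$; (LT) for some continuous t-norm $*$: for all $\varepsilon,\lambda,\lambda'\in\,]0,1]$ with $(1-\lambda')*(1-\lambda)>1-\varepsilon$ and all $x,y,z\in X$, $\varphi_{\varepsilon,x}(z)\le\varphi_{\lambda,x}(y)+\varphi_{\lambda',y}(z)$; (LH) for all $x\ne y$ in $X$ there exists $\lambda$ with $0<\lambda\le 1$ and $\varphi_{\lambda,x}(y)>0$.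
   Context: A continuous t-norm is a binary operation $*$ on $[0,1]$ such that $([0,1],*,1)$ is a commutative monoid, $*:[0,1]^2\to[0,1]$ is continuous, and $p*q\le p'*q'$ whenever $p\le p'$, $q\le q'$. A distance distribution is a nondecreasing function $\varphi:[0,\infty]\to[0,1]$ with $\varphi(0)=0$, $\varphi(\infty)=1$, left-continuous on $]0,\infty[$. The largest one, $\varepsilon_0$, has $\varepsilon_0(0)=0$ and $\varepsilon_0(t)=1$ for $t>0$. A probabilistic metric space $(X,\alpha,* )$ is a set $X$ with a map $\alpha:X\times X\times[0,\infty]\to[0,1]$ and a continuous t-norm $*$ such that for all $x,y,z\in X$, $r,s\in[0,\infty]$: (P1) $\alpha(x,y,-)$ is a distance distribution; (P2) $\alpha(x,x,-)=\varepsilon_0$; (P3) $\alpha(x,y,r)=\alpha(y,x,r)$; (P4) $\alpha(x,y,-)=\varepsilon_0$ implies $x=y$; (P5) $\alpha(y,z,r)*\alpha(x,y,s)\le\alpha(x,z,r+s)$. An ideal in $[0,\infty]^X$ (pointwise order) is a nonempty subset that is downward closed and closed under finite pointwise suprema; an ideal basis is a nonempty subset $\mathcal{B}$ such that for all $\varphi,\psi\in\mathcal{B}$ there is $\chi\in\mathcal{B}$ with $\varphi\vee\psi\le\chi$. A local system on $X$ is a family $(\mathcal{A}(x))_{x\in X}$ of ideals in $[0,\infty]^X$ such that for all $x\in X$: (A1) $\varphi(x)=0$ for all $\varphi\in\mathcal{A}(x)$; (A2) if $\varphi\in[0,\infty]^X$ is such that for all $\varepsilon>0$ and $\omega<\infty$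 there is $\varphi_\varepsilon^\omega\in\mathcal{A}(x)$ with $\varphi\wedge\omega\le\varphi_\varepsilon^\omega+\varepsilon$, then $\varphi\in\mathcal{A}(x)$; (A3) for all $\varphi\in\mathcal{A}(x)$, $\varepsilon>0$, $\omega<\infty$ there is $(\varphi_z)_{z\in X}\in\prod_{z\in X}\mathcal{A}(z)$ such that for all $y,z\in X$: $\varphi(z)\wedge\omega\le\varphi_x(y)+\varphi_y(z)+\varepsilon$. An approach space is a set endowed with a local system. A local basis on $X$ is a family $(\mathcal{B}(x))_{x\in X}$ of ideal bases in $[0,\infty]^X$ satisfying (A1) and (A3) (with $\mathcal{B}$ in place of $\mathcal{A}$) for all $x\in X$. The saturation of $\mathcal{B}\subseteq[0,\infty]^X$ is $\langle\mathcal{B}\rangle=\{\varphi\in[0,\infty]^X\mid\forall\varepsilon>0,\forall\omega<\infty,\exists\varphi_\varepsilon^\omega\in\mathcal{B}:\varphi\wedge\omega\le\varphi_\varepsilon^\omega+\varepsilon\}$. A local basis $(\mathcal{B}(x))_x$ generates the local system $(\langle\mathcal{B}(x)\rangle)_x$. The underlying approach space $\Gamma(X,\alpha,* )$ of a probabilistic metric space $(X,\alpha,* )$ is the set $X$ with the local system generated by the local basis $\{\varphi^\alpha_{\lambda,x}\mid 0<\lambda\le1\}$, $x\in X$, where $\varphi^\alpha_{\lambda,x}(y)=\inf\{0\le\gamma<\infty\mid\alpha(x,y,\gamma)>1-\lambda\}$ (with $\inf\emptyset=\infty$). An approach space $X$ is probabilistic metrizable if it is the underlying approach space of some probabilistic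 metric space $(X,\alpha,* )$, for some continuous t-norm $*$. *)

(* Defs.v *)
From mathcomp Require Import all_boot all_order all_algebra.
From mathcomp Require Import all_classical all_reals all_analysis.
Set Implicit Arguments.
Unset Strict Implicit.
Unset Printing Implicit Defensive.
Import Order.TTheory GRing.Theory Num.Theory.
Import numFieldNormedType.Exports.
Local Open Scope classical_set_scope.
Local Open Scope ring_scope.

(* Encoding: [0,1] is the interval of R and [0,oo] is the nonnegative part of
   \bar R.  Operations are total functions, constrained only on these domains;
   their values elsewhere are irrelevant. *)

Record continuous_tnorm (R : realType) (op : R -> R -> R) : Prop := {
  tnorm_itv : {in `[0, 1] &, forall p q, op p q \in `[0, 1]} ;
  tnormA : {in `[0, 1] & &, associative op} ;
  tnormC : {in `[0, 1] &, commutative op} ;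
  tnorm1 : {in `[0, 1], left_id 1 op} ;
  tnorm_homo : {in `[0, 1] &, forall p q, {in `[0, 1] &, forall p' q',
    p <= p' -> q <= q' -> op p q <= op p' q'}} ;
  tnorm_continuous : {within `[0, 1]%classic `*` `[0, 1]%classic,
    continuous (fun pq : R * R => op pq.1 pq.2)} }.

Record distance_distribution (R : realType) (f : \bar R -> R) : Prop := {
  ddist_itv : forall t, (0 <= t)%E -> f t \in `[0, 1] ;
  ddist_homo : forall s t, (0 <= s)%E -> (s <= t)%E -> f s <= f t ;
  ddist0 : f 0%E = 0 ;
  ddisty : f +oo%E = 1 ;
  ddist_left_continuous : forall t : R, 0 < t -> f s%:E @[s --> t^'-] --> f t%:E }.

Definition eps0 (R : realType) (t : \bar R) : R := if (0 < t)%E then 1 else 0.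

Record probabilistic_metric (R : realType) (X : Type)
    (alpha : X -> X -> \bar R -> R) (op : R -> R -> R) : Prop := {
  pm_tnorm : continuous_tnorm op ;
  pm_ddist : forall x y, distance_distribution (alpha x y) ;
  pm_refl : forall x t, (0 <= t)%E -> alpha x x t = eps0 t ;
  pm_sym : forall x y r, (0 <= r)%E -> alpha x y r = alpha y x r ;
  pm_sep : forall x y,
    (forall t, (0 <= t)%E -> alpha x y t = eps0 t) -> x = y ;
  pm_triangle : forall x y z r s, (0 <= r)%E -> (0 <= s)%E ->
    op (alpha y z r) (alpha x y s) <= alpha x z (r + s)%E }.

(* [0,oo]^X *)
Definition nneg_fun (R : realType) (X : Type) : set (X -> \bar R) :=
  [set phi | forall y, (0 <= phi y)%E].
Arguments nneg_fun : clear implicits.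

(* The supremum of the empty family, the zero function, belongs to any nonempty
   downward closed set, so binary suprema suffice. *)
Record ideal (R : realType) (X : Type) (I : set (X -> \bar R)) : Prop := {
  ideal_nneg : I `<=` nneg_fun R X ;
  ideal_nonempty : I !=set0 ;
  ideal_down : forall phi psi, nneg_fun R X phi -> I psi ->
    (forall y, (phi y <= psi y)%E) -> I phi ;
  ideal_sup : forall phi psi, I phi -> I psi -> I (phi \max psi) }.

Record ideal_basis (R : realType) (X : Type) (B : set (X -> \bar R)) : Prop := {
  ideal_basis_nneg : B `<=` nneg_fun R X ;
  ideal_basis_nonempty : B !=set0 ;
  ideal_basis_directed : forall phi psi, B phi -> B psi ->
    exists2 chi, B chi & forall y, (Order.max (phi y) (psi y) <= chi y)%E }.

Definition saturation (R : realType) (X : Type) (B : set (X -> \bar R)) :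
    set (X -> \bar R) :=
  [set phi | nneg_fun R X phi /\
    forall eps omega : R, 0 < eps -> 0 <= omega ->
      exists2 psi, B psi &
        forall y, (Order.min (phi y) omega%:E <= psi y + eps%:E)%E].

Definition axiomA1 (R : realType) (X : Type) (A : X -> set (X -> \bar R)) : Prop :=
  forall x phi, A x phi -> phi x = 0%E.

Definition axiomA2 (R : realType) (X : Type) (A : X -> set (X -> \bar R)) : Prop :=
  forall x, saturation (A x) `<=` A x.

Definition axiomA3 (R : realType) (X : Type) (A : X -> set (X -> \bar R)) : Prop :=
  forall x phi, A x phi -> forall eps omega : R, 0 < eps -> 0 <= omega ->
    exists2 phi_ : X -> X -> \bar R, (forall z, A z (phi_ z)) &
      forall y z,
        (Order.min (phi z) omega%:E <= phi_ x y + phi_ y z + eps%:E)%E.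

Record local_system (R : realType) (X : Type) (A : X -> set (X -> \bar R)) :
    Prop := {
  local_system_ideal : forall x, ideal (A x) ;
  local_system_A1 : axiomA1 A ;
  local_system_A2 : axiomA2 A ;
  local_system_A3 : axiomA3 A }.

Record local_basis (R : realType) (X : Type) (B : X -> set (X -> \bar R)) :
    Prop := {
  local_basis_ideal_basis : forall x, ideal_basis (B x) ;
  local_basis_A1 : axiomA1 B ;
  local_basis_A3 : axiomA3 B }.

Definition local_basis_of (R : realType) (X : Type)
    (A B : X -> set (X -> \bar R)) : Prop :=
  local_basis B /\ forall x, A x = saturation (B x).

Definition pm_phi (R : realType) (X : Type) (alpha : X -> X -> \bar R -> R)
    (lambda : R) (x y : X) : \bar R :=
  ereal_inf [set gamma%:E | gamma in
    [set gamma : R | 0 <= gamma /\ 1 - lambda < alpha x y gamma%:E]].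

Definition basis_family (R : realType) (X : Type) (phi : R -> X -> X -> \bar R)
    (x : X) : set (X -> \bar R) :=
  [set phi lambda x | lambda in `]0, 1]%classic].

Definition underlying_approach (R : realType) (X : Type)
    (alpha : X -> X -> \bar R -> R) (A : X -> set (X -> \bar R)) : Prop :=
  local_basis_of A (basis_family (pm_phi alpha)).

Definition probabilistic_metrizable (R : realType) (X : Type)
    (A : X -> set (X -> \bar R)) : Prop :=
  exists (op : R -> R -> R) (alpha : X -> X -> \bar R -> R),
    probabilistic_metric alpha op /\ underlying_approach alpha A.

(* Main.v *)
Require Import Defs.
From mathcomp Require Import all_boot all_order all_algebra.
From mathcomp Require Import all_classical all_reals all_analysis.
From mathcomp Require Import lra.
Set Implicit Arguments.
Unset Strict Implicit.
Unset Printing Implicit Defensive.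
Import Order.TTheory GRing.Theory Num.Theory.
Import numFieldNormedType.Exports.
Local Open Scope classical_set_scope.
Local Open Scope ring_scope.

(** A probabilistic metric [alpha] and a family [phi] carry the same
    information. For fixed points [x] and [y], the functions
    [t |-> alpha x y t] and [l |-> phi l x y] are generalized inverses of each
    other: the former is nondecreasing and left-continuous, the latter
    nonincreasing and, by (LD), equal at [l] to its infimum over [r < l], and
    both are tied together, for [0 < l <= 1] and finite [t], by the Galois
    correspondence
    [[
      1 - l < alpha x y t <-> phi l x y < t.
    ]]
    The axioms of a probabilistic metric space then translate one by one:
    symmetry into (LS), left-continuity into (LD) and separation into (LH).
    The triangle inequality [alpha y z r * alpha x y s <= alpha x z (r + s)]
    becomes (LT) with the same t-norm.

    In the direct implication, [pm_phi alpha] is the required family. It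
    generates the given approach structure by assumption, and the lemmas
    [pm_phi_sym], [pm_phi_inf], [pm_phi_triangle] and [pm_phi_gt0] provide the
    four conditions.

    Conversely, [level_distribution] builds [alpha] from [phi]. The
    correspondence is [level_distribution_gt], and it yields all the axioms.
    Continuity of the t-norm enters only in the triangle inequality
    ([level_distribution_triangle]), because (LT) requires strict inequalities
    between confidence levels: a strict bound [c < p * q] has to be
    witnessed at levels strictly below [p] and [q] ([tnorm_gt_below]). Finally
    [pm_phi alpha] is [phi] itself on [0 < l <= 1] ([pm_phi_level]), so that
    both have literally the same local basis, and no saturation has to be
    computed. *)

(** * Continuous t-norms *)

Lemma tnorm0l (R : realType) (op : R -> R -> R) (q : R) :
  continuous_tnorm op -> q \in `[0, 1] -> op 0 q = 0.
Proof.
move=> top q01.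
have i0 : (0 : R) \in `[0, 1] by rewrite in_itv/= lexx ler01.
have i1 : (1 : R) \in `[0, 1] by rewrite in_itv/= lexx ler01.
apply/eqP; rewrite eq_le; apply/andP; split.
  rewrite -[leRHS](tnorm1 top i0) (tnormC top i1 i0).
  by apply: (tnorm_homo top) => //; move: q01; rewrite in_itv/= => /andP[].
by have := tnorm_itv top i0 q01; rewrite in_itv/= => /andP[].
Qed.

Lemma tnormr0 (R : realType) (op : R -> R -> R) (p : R) :
  continuous_tnorm op -> p \in `[0, 1] -> op p 0 = 0.
Proof.
move=> top p01; rewrite (tnormC top)// ?tnorm0l//.
by rewrite in_itv/= lexx ler01.
Qed.

(** Lower semicontinuity of the t-norm, along decreasing arguments: 0 being
    absorbing, [c < op p q] with [0 <= c] leaves room below [p] and [q], and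
    continuity at [(p, q)] provides the smaller arguments. *)
Lemma tnorm_gt_below (R : realType) (op : R -> R -> R) (p q c : R) :
  continuous_tnorm op -> p \in `[0, 1] -> q \in `[0, 1] ->
  0 <= c -> c < op p q ->
  exists p' q', [/\ 0 <= p' < p, 0 <= q' < q & c < op p' q'].
Proof.
move=> top p01 q01 c0 cpq.
have [p_ge0 p_le1] : 0 <= p /\ p <= 1 by move: p01; rewrite in_itv/= => /andP[].
have [q_ge0 q_le1] : 0 <= q /\ q <= 1 by move: q01; rewrite in_itv/= => /andP[].
have p_gt0 : 0 < p.
  rewrite lt_neqAle p_ge0 andbT; apply/eqP => p0.
  by move: cpq; rewrite -p0 tnorm0l// ltNge c0.
have q_gt0 : 0 < q.
  rewrite lt_neqAle q_ge0 andbT; apply/eqP => q0.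
  by move: cpq; rewrite -q0 tnormr0// ltNge c0.
have /subspace_continuousP/(_ (p, q)) := tnorm_continuous top.
move=> /(_ (conj p01 q01)) /cvgrPdist_lt/(_ (op p q - c)).
rewrite subr_gt0 => /(_ cpq); rewrite near_withinE => /nbhs_ballP[d /= d0 dP].
have below (r : R) : 0 < r -> r <= 1 ->
    exists r', [/\ 0 <= r' < r, r' \in `[0, 1] & ball r d r'].
  move=> r0 r1; exists (Num.max 0 (r - d / 2)).
  have [h|h] := leP 0 (r - d / 2); rewrite ?in_itv/= /ball/=.
    split; [lra|lra|rewrite ger0_norm; lra].
  split; [lra|lra|rewrite ger0_norm; lra].
have [p' [p'p p'01 dp]] := below p p_gt0 p_le1.
have [q' [q'q q'01 dq]] := below q q_gt0 q_le1.
exists p', q'; split => //.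
have := dP (p', q') (conj dp dq) (conj p'01 q'01) => /= h.
have : op p q - op p' q' < op p q - c := le_lt_trans (ler_norm _) h.
by rewrite ltrD2l ltrN2.
Qed.

(** * From a probabilistic metric to its family of functions *)

Lemma lee_add_above (R : realType) (a b c : \bar R) : (0 <= a)%E -> (0 <= b)%E ->
  (forall s t, (a < s)%E -> (b < t)%E -> (c <= s + t)%E) -> (c <= a + b)%E.
Proof.
case: a b => [a| |] [b| |]// _ _ h; rewrite ?addye ?addey ?leey//.
apply/lee_addgt0Pr => e e0.
apply: le_trans (h (a + e / 2)%:E (b + e / 2)%:E _ _) _;
  rewrite ?lte_fin; [lra|lra|].
by rewrite -!EFinD lee_fin; lra.
Qed.

Section pm_phi_theory.
Context {R : realType} {X : Type}.
Variable alpha : X -> X -> \bar R -> R.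
Implicit Types (lambda : R) (x y z : X).

Lemma pm_phi_ge0 lambda x y : (0 <= pm_phi alpha lambda x y)%E.
Proof. by apply/ereal_infP => _ [g [g0 _] <-]; rewrite lee_fin. Qed.

Lemma pm_phi_le lambda x y (g : R) :
  0 <= g -> 1 - lambda < alpha x y g%:E -> (pm_phi alpha lambda x y <= g%:E)%E.
Proof. by move=> g0 h; apply: ereal_inf_lbound; exists g. Qed.

Lemma pm_phi_ltP lambda x y (t : \bar R) :
  (pm_phi alpha lambda x y < t)%E <->
  exists g : R, [/\ 0 <= g, 1 - lambda < alpha x y g%:E & (g%:E < t)%E].
Proof.
split=> [/ereal_inf_ltP[_ [g [g0 h] <-] gt]|[g [g0 h gt]]]; first by exists g.
exact: le_lt_trans (pm_phi_le g0 h) gt.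
Qed.

Lemma pm_phi_sym op lambda x y : probabilistic_metric alpha op ->
  pm_phi alpha lambda x y = pm_phi alpha lambda y x.
Proof.
move=> pm; congr ereal_inf; apply/seteqP.
by split=> _ [g [g0 h] <-]; exists g => //; split => //;
  rewrite (pm_sym pm) ?lee_fin.
Qed.

(** The strict inequality [1 - lambda < alpha x y g] is open in [lambda]: it
    persists for some smaller [rho], whence the infimum. *)
Lemma pm_phi_inf op lambda x y : probabilistic_metric alpha op ->
  0 < lambda <= 1 -> pm_phi alpha lambda x y =
    ereal_inf [set pm_phi alpha rho x y | rho in `]0, lambda[%classic].
Proof.
move=> pm /andP[l0 l1]; apply/eqP; rewrite eq_le; apply/andP; split.
  apply/ereal_infP => _ [r /= + <-]; rewrite in_itv/= => /andP[r0 rl].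
  apply/ereal_infP => _ [g [g0 h] <-]; apply: pm_phi_le => //.
  by apply: le_lt_trans h; lra.
apply/ereal_infP => _ [g [g0 h] <-].
have [a0 a1] : 0 <= alpha x y g%:E /\ alpha x y g%:E <= 1.
  have := ddist_itv (pm_ddist pm x y) (t := g%:E).
  by rewrite lee_fin in_itv/= => /(_ g0)/andP[].
(* Any number strictly between [1 - alpha x y g] and [lambda] would do. *)
pose r := (1 - alpha x y g%:E + lambda) / 2.
apply: ge_ereal_inf; exists (pm_phi alpha r x y).
  by exists r => //=; rewrite in_itv/= /r; lra.
by apply: pm_phi_le => //; rewrite /r; lra.
Qed.

Lemma pm_phi_triangle op (eps lambda lambda' : R) x y z :
  probabilistic_metric alpha op -> 0 < lambda <= 1 -> 0 < lambda' <= 1 ->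
  1 - eps < op (1 - lambda') (1 - lambda) ->
  (pm_phi alpha eps x z <= pm_phi alpha lambda x y + pm_phi alpha lambda' y z)%E.
Proof.
move=> pm /andP[l0 l1] /andP[l'0 l'1] eop.
have a01 u v (t : R) : 0 <= t -> alpha u v t%:E \in `[0, 1].
  by move=> t0; apply: (ddist_itv (pm_ddist pm u v)); rewrite lee_fin.
apply: lee_add_above; [exact: pm_phi_ge0|exact: pm_phi_ge0|].
move=> s t /pm_phi_ltP[g [g0 hg /ltW gs]] /pm_phi_ltP[g' [g'0 hg' /ltW g't]].
apply: le_trans (leeD gs g't); rewrite -EFinD; apply: pm_phi_le.
  exact: addr_ge0.
apply: lt_le_trans eop _; rewrite (addrC g) EFinD.
apply: le_trans (pm_triangle pm x y z _ _); rewrite ?lee_fin//.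
have [il il'] : 1 - lambda \in `[0, 1] /\ 1 - lambda' \in `[0, 1].
  by rewrite !in_itv/=; split; lra.
by apply: (tnorm_homo (pm_tnorm pm)) => //;
  [exact: a01|exact: a01|exact: ltW|exact: ltW].
Qed.

(** If [pm_phi alpha lambda x y] vanishes for every [lambda], then
    [alpha x y t] exceeds every [1 - lambda] as soon as [t > 0]. *)
Lemma pm_phi_gt0 op x y : probabilistic_metric alpha op -> x <> y ->
  exists2 lambda : R, 0 < lambda <= 1 & (0 < pm_phi alpha lambda x y)%E.
Proof.
move=> pm xy; apply: contrapT => none; apply: xy.
have dxy := pm_ddist pm x y.
apply: (pm_sep pm) => t t0; rewrite /eps0.
have [tgt0|] := ltP 0%E t; last first.
  by move=> tle0; rewrite (_ : t = 0%E) ?(ddist0 dxy)//; apply/le_anti/andP.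
have := ddist_itv dxy t0; rewrite in_itv/= => /andP[a0 a1].
apply/eqP; rewrite eq_le a1/= leNgt; apply/negP => alt1.
have l01 : 0 < 1 - alpha x y t <= 1 by lra.
apply: none; exists (1 - alpha x y t) => //.
rewrite lt_neqAle pm_phi_ge0 andbT; apply/eqP => phi0.
have /pm_phi_ltP[g [g0 h /ltW gt]] : (pm_phi alpha (1 - alpha x y t) x y < t)%E.
  by rewrite -phi0.
have := ddist_homo dxy (s := g%:E) _ gt; rewrite lee_fin => /(_ g0).
by lra.
Qed.

End pm_phi_theory.

(** * From a family of functions to a probabilistic metric *)

(** The family [l |-> phi l x y] determines [alpha x y] as its generalized
    inverse: [alpha x y t] is the least upper bound of the confidences [1 - l]
    at which the distance from [x] to [y] is less than [t]. The supremum of the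
    empty set is 0, as wanted; at infinity the value 1 has to be imposed, as
    all the [phi l x y] may be infinite. *)
Definition level_distribution (R : realType) (f : R -> \bar R) (t : \bar R) : R :=
  if t == +oo%E then 1 else
  sup [set 1 - l | l in [set l | 0 < l <= 1 /\ (f l < t)%E]].

Lemma eq_level_distribution (R : realType) (f g : R -> \bar R) t :
  (forall l : R, 0 < l <= 1 -> f l = g l) ->
  level_distribution f t = level_distribution g t.
Proof.
move=> fg; rewrite /level_distribution; case: ifP => // _; congr sup.
by apply/seteqP; split=> _ [l [l01 h] <-]; exists l => //; split => //;
  move: h; rewrite fg.
Qed.

Section level_distribution_theory.
Context {R : realType} (f : R -> \bar R).
Hypothesis f_ge0 : forall l : R, 0 < l <= 1 -> (0 <= f l)%E.
Hypothesis f_inf : forall l : R, 0 < l <= 1 ->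
  f l = ereal_inf [set f r | r in `]0, l[%classic].
Local Notation F := (level_distribution f).
Implicit Types (l c : R) (s t : \bar R).

Let level_set_ub t :
  ubound [set 1 - l | l in [set l | 0 < l <= 1 /\ (f l < t)%E]] 1.
Proof. by move=> _ [l [/andP[l0 l1] _] <-]; lra. Qed.

Lemma level_distributiony : F +oo%E = 1.
Proof. by rewrite /level_distribution eqxx. Qed.

Lemma level_distribution_itv t : F t \in `[0, 1].
Proof.
rewrite /level_distribution in_itv/=; case: ifP => _.
  by rewrite ler01 lexx.
set S := (X in sup X).
have [->|/set0P[c Sc]] := eqVneq S set0; first by rewrite sup0 lexx ler01.
apply/andP; split; last by apply: ge_sup; [exists c|exact: level_set_ub].
have [l [/andP[l0 l1] _] lc] := Sc.
apply: (@le_trans _ _ c); first by lra.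
by apply: ub_le_sup => //; exists 1; exact: level_set_ub.
Qed.

(** The Galois correspondence between [f] and its generalized inverse. The
    infimum condition on [f] makes it an exact equivalence between strict
    inequalities, and all the other properties are read off from it. *)
Lemma level_distribution_gt l t : 0 < l <= 1 -> t != +oo%E ->
  (1 - l < F t) = (f l < t)%E.
Proof.
move=> l01 tNy; have /andP[l0 l1] := l01.
rewrite /level_distribution (negbTE tNy); set S := (X in sup X).
apply/idP/idP => [lS|].
  have S0 : S !=set0.
    apply/set0P/eqP => S0; move: lS; rewrite S0 sup0; lra.
  have [_ [m [/andP[m0 m1] fmt] <-] lm] := sup_gt S0 lS.
  rewrite f_inf//; apply/ereal_inf_ltP; exists (f m) => //.
  by exists m => //=; rewrite in_itv/=; lra.
rewrite {1}f_inf// => /ereal_inf_ltP[_ [r /= + <-] frt].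
rewrite in_itv/= => /andP[r0 rl]; apply: (@lt_le_trans _ _ (1 - r)); first by lra.
apply: ub_le_sup; first by exists 1; exact: level_set_ub.
by exists r => //; split => //; lra.
Qed.

Lemma level_distribution_gtE c t : 0 <= c < 1 -> t != +oo%E ->
  (c < F t) = (f (1 - c) < t)%E.
Proof.
move=> c01 tNy; rewrite -level_distribution_gt//; last by lra.
by congr (_ < _); lra.
Qed.

Lemma level_distribution_homo s t : (s <= t)%E -> F s <= F t.
Proof.
have [->|tNy] := eqVneq t +oo%E.
  rewrite level_distributiony; have := level_distribution_itv s.
  by rewrite in_itv/= => /andP[].
move=> st; have sNy : s != +oo%E.
  by apply: contra tNy => /eqP sy; rewrite -leye_eq -sy.
rewrite leNgt; apply/negP => ts.
have := level_distribution_itv t; have := level_distribution_itv s.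
rewrite !in_itv/= => /andP[s0 s1] /andP[t0 t1].
have c01 : 0 <= F t < 1 by lra.
move: ts; rewrite level_distribution_gtE// => /lt_le_trans/(_ st).
by rewrite -level_distribution_gtE// ltxx.
Qed.

Lemma level_distribution0 : F 0%E = 0.
Proof.
have := level_distribution_itv 0%E; rewrite in_itv/= => /andP[F0 _].
apply/eqP; rewrite eq_le F0 andbT leNgt level_distribution_gtE//; last by lra.
by rewrite -leNgt f_ge0//; lra.
Qed.

Lemma level_distribution_left_continuous (t : R) :
  F s%:E @[s --> t^'-] --> F t%:E.
Proof.
apply/cvgrPdist_lt => e e0.
have := level_distribution_itv t%:E; rewrite in_itv/= => /andP[Ft0 Ft1].
suff [s0 s0t Fs0] : exists2 s0 : R, s0 < t & F t%:E - e < F s0%:E.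
  near=> s.
  have st : s < t by near: s; exact: nbhs_left_lt.
  have s0s : s0 < s by near: s; exact: nbhs_left_gt.
  have h1 : F s%:E <= F t%:E.
    by apply: level_distribution_homo; rewrite lee_fin ltW.
  have h2 : F s0%:E <= F s%:E.
    by apply: level_distribution_homo; rewrite lee_fin ltW.
  by rewrite ger0_norm; lra.
have [c_lt0|c_ge0] := ltP (F t%:E - e) 0.
  exists (t - 1); first by lra.
  apply: lt_le_trans c_lt0 _.
  by have := level_distribution_itv (t - 1)%:E; rewrite in_itv/= => /andP[].
(* By the Galois correspondence, any [s0] strictly between
   [f (1 - (F t - e))] and [t] will do. *)
have c01 : 0 <= F t%:E - e < 1 by lra.
have : F t%:E - e < F t%:E by lra.
have : (0 <= f (1 - (F t%:E - e)))%E by apply: f_ge0; lra.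
rewrite level_distribution_gtE//; case E : (f _) => [v| |]// _.
rewrite lte_fin => vt; exists ((v + t) / 2); first by lra.
by rewrite level_distribution_gtE// E lte_fin; lra.
Unshelve. all: by end_near. Qed.

Lemma distance_distribution_level : distance_distribution F.
Proof.
split.
- by move=> t _; exact: level_distribution_itv.
- by move=> s t _; exact: level_distribution_homo.
- exact: level_distribution0.
- exact: level_distributiony.
- by move=> t _; exact: level_distribution_left_continuous.
Qed.

(** Taking the generalized inverse twice gives back [f]. The left-hand side is
    the formula that defines [pm_phi], for a single pair of points. *)
Lemma ereal_inf_level_distribution l : 0 < l <= 1 ->
  ereal_inf [set g%:E | g in [set g : R | 0 <= g /\ 1 - l < F g%:E]] = f l.
Proof.
move=> l01; apply/eqP; rewrite eq_le; apply/andP; split; last first.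
  by apply/ereal_infP => _ [g [g0 h] <-]; rewrite ltW// -level_distribution_gt.
have := f_ge0 l01; case E : (f l) => [v| |]// v0; last by rewrite leey.
apply/lee_addgt0Pr => e e0; apply: ereal_inf_lbound.
exists (v + e); last by rewrite EFinD.
move: v0; rewrite lee_fin => v0; split; first by lra.
by rewrite level_distribution_gt// E lte_fin; lra.
Qed.

(** This is how separation is transferred: the points of a pair at which
    [alpha] is trivial cannot be distinguished by [phi] either. *)
Lemma level_distribution_eps0 :
  (forall t, (0 <= t)%E -> F t = eps0 t) -> forall l : R, 0 < l <= 1 -> f l = 0%E.
Proof.
move=> Feps l l01; have /andP[l0 l1] := l01.
apply/eqP; rewrite eq_le f_ge0// andbT.
apply/lee_addgt0Pr => e e0; rewrite add0e ltW// -level_distribution_gt//.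
by rewrite Feps ?lee_fin ?ltW// /eps0 lte_fin e0; lra.
Qed.

End level_distribution_theory.

Section metric_of_family.
Context {R : realType} {X : Type} (phi : R -> X -> X -> \bar R)
  (op : R -> R -> R).
Hypothesis phi_ge0 : forall (l : R) x y, 0 < l <= 1 -> (0 <= phi l x y)%E.
Hypothesis phi_refl : forall (l : R) x, 0 < l <= 1 -> phi l x x = 0%E.
Hypothesis phi_sym : forall (l : R) x y, 0 < l <= 1 -> phi l x y = phi l y x.
Hypothesis phi_inf : forall (l : R) x y, 0 < l <= 1 ->
  phi l x y = ereal_inf [set phi r x y | r in `]0, l[%classic].
Hypothesis op_tnorm : continuous_tnorm op.
Hypothesis phi_triangle : forall eps l l' : R,
  0 < eps <= 1 -> 0 < l <= 1 -> 0 < l' <= 1 ->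
  1 - eps < op (1 - l') (1 - l) ->
  forall x y z, (phi eps x z <= phi l x y + phi l' y z)%E.
Hypothesis phi_sep : forall x y, x <> y ->
  exists2 l : R, 0 < l <= 1 & (0 < phi l x y)%E.
Local Notation alpha := (fun x y => level_distribution (fun l => phi l x y)).

Let alpha_itv x y t : alpha x y t \in `[0, 1].
Proof. exact: level_distribution_itv. Qed.

Let alpha_gtE (c : R) x y (t : \bar R) : 0 <= c < 1 -> t != +oo%E ->
  (c < alpha x y t) = (phi (1 - c) x y < t)%E.
Proof. by apply: level_distribution_gtE => l; exact: phi_inf. Qed.

(** If the inequality failed, [tnorm_gt_below] would give confidences [p' < alpha y z r] and [q' < alpha x y s] with
    [alpha x z (r + s) < op p' q']; the Galois correspondence turns these into
    [phi (1 - p') y z < r] and [phi (1 - q') x y < s], and the triangle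
    inequality for [phi] then bounds [phi (1 - alpha x z (r + s)) x z] strictly
    below [r + s], against the same correspondence. *)
Lemma level_distribution_triangle x y z (r s : \bar R) :
  (0 <= r)%E -> (0 <= s)%E ->
  op (alpha y z r) (alpha x y s) <= alpha x z (r + s)%E.
Proof.
move=> r0 s0; have opi := tnorm_itv op_tnorm (alpha_itv y z r) (alpha_itv x y s).
have /andP[op0 op1] : 0 <= op (alpha y z r) (alpha x y s) <= 1.
  by move: opi; rewrite in_itv/=.
have [rsy|rsNy] := eqVneq (r + s)%E +oo%E.
  by rewrite rsy level_distributiony.
have [rNy sNy] : r != +oo%E /\ s != +oo%E.
  by split; apply: contra rsNy => /eqP ->;
    rewrite ?addye ?addey// gt_eqF// (lt_le_trans _ r0, lt_le_trans _ s0) ?ltNyr.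
have /andP[c0 _] : 0 <= alpha x z (r + s)%E <= 1.
  by have := alpha_itv x z (r + s)%E; rewrite in_itv/=.
rewrite leNgt; apply/negP => cop.
have [p [q [/andP[p0 pr] /andP[q0 qs] cpq]]] :=
  tnorm_gt_below op_tnorm (alpha_itv y z r) (alpha_itv x y s) c0 cop.
have /andP[_ r1] : 0 <= alpha y z r <= 1.
  by have := alpha_itv y z r; rewrite in_itv/=.
have /andP[_ s1] : 0 <= alpha x y s <= 1.
  by have := alpha_itv x y s; rewrite in_itv/=.
have /andP[p01 q01] : (0 <= p < 1) && (0 <= q < 1) by lra.
move: pr qs; rewrite !alpha_gtE// => pr qs.
set c := level_distribution _ (r + s)%E in c0 cop cpq.
have c01 : 0 <= c < 1 by lra.
have cpq' : 1 - (1 - c) < op (1 - (1 - p)) (1 - (1 - q)) by rewrite !subKr.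
have tri : (phi (1 - c) x z <= phi (1 - q) x y + phi (1 - p) y z)%E.
  by apply: phi_triangle cpq' _ _ _; lra.
have := le_lt_trans tri (lteD qs pr).
by rewrite (addeC s) -alpha_gtE// ltxx.
Qed.

Lemma probabilistic_metric_level : probabilistic_metric alpha op.
Proof.
split => //.
- by move=> x y; apply: distance_distribution_level => l;
    [exact: phi_ge0|exact: phi_inf].
- move=> x t t0; rewrite /eps0.
  have [->|tNy] := eqVneq t +oo%E; first by rewrite level_distributiony ltry.
  have [tgt0|tle0] := ltP 0%E t; last first.
    have -> : t = 0%E by apply/le_anti/andP.
    by apply: level_distribution0 => l; [exact: phi_ge0|exact: phi_inf].
  have := alpha_itv x x t; rewrite in_itv/= => /andP[a0 a1].
  apply/eqP; rewrite eq_le a1/= leNgt; apply/negP => alt1.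
  have : ~~ (alpha x x t < alpha x x t) by rewrite ltxx.
  rewrite alpha_gtE//; last by lra.
  by rewrite phi_refl ?tgt0//; lra.
- by move=> x y r _; apply: eq_level_distribution => l; exact: phi_sym.
- move=> x y axy; apply: contrapT => /phi_sep[l l01].
  rewrite (level_distribution_eps0 _ _ axy l01) ?ltxx// => m.
    exact: phi_ge0.
  exact: phi_inf.
- exact: level_distribution_triangle.
Qed.

Lemma pm_phi_level l x y : 0 < l <= 1 -> pm_phi alpha l x y = phi l x y.
Proof.
move=> l01; apply: (ereal_inf_level_distribution (f := fun l => phi l x y))
  => // m.
  exact: phi_ge0.
exact: phi_inf.
Qed.

Lemma basis_family_pm_phi_level : basis_family (pm_phi alpha) = basis_family phi.
Proof.
apply/funext => x; apply/seteqP; split=> _ [l /= l01 <-]; exists l => //;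
  move: l01; rewrite in_itv/= => l01; apply/funext => y;
  by rewrite pm_phi_level.
Qed.

End metric_of_family.

Theorem theorem3p9 (R : realType) (X : Type) (A : X -> set (X -> \bar R))
    (hA : local_system A) :
  probabilistic_metrizable A <->
  exists phi : R -> X -> X -> \bar R,
    (forall lambda x y, 0 < lambda <= 1 -> (0 <= phi lambda x y)%E) /\
    local_basis_of A (basis_family phi) /\
    (* LS *)
    (forall lambda x y, 0 < lambda <= 1 -> phi lambda x y = phi lambda y x) /\
    (* LD *)
    (forall lambda x y, 0 < lambda <= 1 ->
      phi lambda x y = ereal_inf [set phi rho x y | rho in `]0, lambda[%classic]) /\
    (* LT *)
    (exists2 op : R -> R -> R, continuous_tnorm op &
      forall eps lambda lambda' : R,
        0 < eps <= 1 -> 0 < lambda <= 1 -> 0 < lambda' <= 1 ->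
        1 - eps < op (1 - lambda') (1 - lambda) ->
        forall x y z, (phi eps x z <= phi lambda x y + phi lambda' y z)%E) /\
    (* LH *)
    (forall x y, x <> y ->
      exists2 lambda : R, 0 < lambda <= 1 & (0 < phi lambda x y)%E).
Proof.
split=> [[op [alpha [pm Aalpha]]]|].
  exists (pm_phi alpha); split; first by move=> *; exact: pm_phi_ge0.
  split=> //; split; first by move=> l x y _; exact: pm_phi_sym pm.
  split; first by move=> l x y; exact: pm_phi_inf pm.
  split; last by move=> x y; exact: pm_phi_gt0 pm.
  exists op; first exact: pm_tnorm pm.
  by move=> eps l l' _ l01 l'01 h x y z; exact: pm_phi_triangle pm l01 l'01 h.
move=> [phi [phi_ge0 [Aphi [phi_sym [phi_inf [[op top phi_tri] phi_sep]]]]]].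
have phi_refl (l : R) x : 0 < l <= 1 -> phi l x x = 0%E.
  move=> l01; apply: (local_basis_A1 Aphi.1 (x := x)).
  by exists l; rewrite //= in_itv.
exists op, (fun x y => level_distribution (fun l => phi l x y)); split.
  exact: probabilistic_metric_level.
by rewrite /underlying_approach basis_family_pm_phi_level.
Qed.
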